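(* Fix $\rho\in(0,1)$. For each $n$ let $X=(X_1,\dots,X_n)'$ be jointly normal with $E[X_i]=0$, $E[X_i^2]=1$ and $\operatorname{Corr}(X_i,X_j)=\rho$ for $i\neq j$, and let $M_n(|X|)=\max_{1\le i\le n}|X_i|$. Let $\widehat\rho=\widehat\rho_n$ be an estimator (a measurable function of $X$ with values in $[0,1)$) satisfying $$\sqrt{2\ln n}\,\left(\sqrt{1-\rho}-\sqrt{1-\widehat\rho}\right)\xrightarrow[n\to\infty]{P}0 .$$ Then $$\left|\int_{-\infty}^{\infty}\Big(\Psi^n_{\sqrt{\rho}z,\sqrt{1-\rho}}\big(M_n(|X|)\big)-\Psi^n_{\sqrt{\widehat\rho}z,\sqrt{1-\widehat\rho}}\big(M_n(|X|)\big)\Big)\phi(z)\,dz\right|\xrightarrow[n\to\infty]{P}0.$$ Consequently $p_0(\rho)-p_0(\widehat\rho)\xrightarrow{P}0$, where $p_0(r)=1-\int_{-\infty}^{\infty}\Psi^n_{\sqrt{r}z,\sqrt{1-r}}\big(M_n(|X|)\big)\phi(z)\,dz$ for $r\in[0,1)$.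
   Context: $\Psi_{\mu,\sigma}$ denotes the cumulative distribution function of the folded normal distribution: $\Psi_{\mu,\sigma}(x)=P(|Y|\le x)$ where $Y\sim N(\mu,\sigma^2)$; $\Psi^n$ denotes its $n$-th power. $\phi$ is the standard normal density. The correlation $\rho$ does not depend on $n$. *)

(* Defs.v *)
From HB Require Import structures.
From mathcomp Require Import all_boot all_order all_algebra.
From mathcomp Require Import all_classical all_reals all_analysis.
Set Implicit Arguments. Unset Strict Implicit. Unset Printing Implicit Defensive.
Import Order.TTheory GRing.Theory Num.Theory.
Import numFieldNormedType.Exports.
Local Open Scope classical_set_scope.
Local Open Scope ring_scope.

Section Defs.
Context {R : realType} {d : measure_display} {T : measurableType d}.
Variable P : probability T R.

(* Jointly normal vector (Cramer-Wold definition): every linear combination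
   sum_i a_i X_i is univariate normal with mean sum_i a_i m_i and variance
   a' C a (a point mass when the variance is 0). *)
Definition jointly_normal n (X : 'I_n -> T -> R) (m : 'I_n -> R)
    (C : 'I_n -> 'I_n -> R) : Prop :=
  forall a : 'I_n -> R,
    let Y := fun t => \sum_(i < n) a i * X i t in
    let mu := \sum_(i < n) a i * m i in
    let v := \sum_(i < n) \sum_(j < n) a i * a j * C i j in
    (0 < v -> forall A : set R, measurable A ->
        P (Y @^-1` A) = normal_prob mu (Num.sqrt v) A) /\
    (v = 0 -> P [set t | Y t = mu] = 1%E).

Definition cvg_in_prob0 (Y : nat -> T -> R) : Prop :=
  forall eps : R, 0 < eps ->
    (fun n => P [set t | eps < `|Y n t|]) @ \oo --> 0%E.
End Defs.

Definition equicorr {R : realType} n (rho : R) : 'I_n -> 'I_n -> R :=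
  fun i j => if i == j then 1 else rho.

Arguments equicorr {R} n rho.

Definition Psi {R : realType} (mu sigma x : R) : R :=
  fine (normal_prob mu sigma `[- x, x]).

Definition phi {R : realType} (z : R) : R := normal_pdf 0 1 z.

Definition IPsi {R : realType} (n : nat) (r x : R) : R :=
  Rintegral (@lebesgue_measure R) [set: R]
    (fun z => Psi (Num.sqrt r * z) (Num.sqrt (1 - r)) x ^+ n * phi z).

Definition p0 {R : realType} (n : nat) (r x : R) : R := 1 - IPsi n r x.

Definition Mabs {R : realType} {T : Type} n (X : 'I_n -> T -> R) (t : T) : R :=
  \big[Num.max/0]_(i < n) `|X i t|.

(* Main.v *)
(* Write a = sqrt(2 ln n) and b = sqrt(1 - r). Gaussian tail bounds show that
   Psi_(m, b)(x)^n tends to 0 where |m| exceeds x - b a by a fixed margin, and to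
   1 where |m| stays below x - b a by a fixed margin, uniformly in m, x and b.
   Hence, up to a small error, the integrand of IPsi n r x is the indicator of
   sqrt(r) |z| <= x - b a, except for z in two short intervals and in the Gaussian
   tails. When a (sqrt(1 - rho) - sqrt(1 - r)) is small, the indicators for rho and
   r agree off a set of small Gaussian measure, so IPsi n rho and IPsi n r are
   uniformly close as functions of x. *)
Require Import Defs.
From HB Require Import structures.
From mathcomp Require Import all_boot all_order all_algebra.
From mathcomp Require Import all_classical all_reals all_analysis.
From mathcomp Require Import measurable_realfun ring lra.
Import Order.TTheory GRing.Theory Num.Theory.
Import numFieldNormedType.Exports.
Local Open Scope classical_set_scope.
Local Open Scope ring_scope.

(** * Normal probabilities of half-lines and intervals *)

(* If [x] lies between [m] and every [t] in [A], then
   [(t - m)^2 >= (t - x)^2 + (x - m)^2], so the density centred at [m] is dominated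
   on [A] by [expR (- (x - m)^2 / (2 s^2))] times the one centred at [x]. *)
Lemma normal_prob_sub_tail (R : realType) (m s x : R) (A : set R) :
  s != 0 -> measurable A ->
  (forall t, A t -> 0 <= (t - x) * (x - m)) ->
  (normal_prob m s A <= (expR (- (x - m) ^+ 2 / (s ^+ 2 *+ 2)))%:E)%E.
Proof.
move=> s0 mA hA.
have s2 : 0 < s ^+ 2 *+ 2 by rewrite pmulrn_lgt0// exprn_even_gt0.
set e := expR _.
apply: (@le_trans _ _ (\int[lebesgue_measure]_(t in A) (e%:E * (normal_pdf x s t)%:E)))%E.
  apply: ge0_le_integral => //=.
  - by move=> t _; rewrite lee_fin normal_pdf_ge0.
  - apply/measurable_EFinP/measurable_funTS; exact: measurable_normal_pdf.
  - apply/measurable_EFinP/measurable_funTS/measurable_funM => //.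
    exact: measurable_normal_pdf.
  - move=> t At; rewrite -EFinM lee_fin !normal_pdfE// mulrCA.
    rewrite ler_wpM2l ?normal_peak_ge0// /normal_fun /e -expRD ler_expR.
    rewrite -mulrDl ler_pM2r ?invr_gt0//.
    by have := hA _ At; nra.
rewrite ge0_integralZl//=; first last.
- by rewrite lee_fin expR_ge0.
- by move=> t _; rewrite lee_fin normal_pdf_ge0.
- apply/measurable_EFinP/measurable_funTS; exact: measurable_normal_pdf.
rewrite -[leRHS]mule1 lee_wpmul2l ?lee_fin ?expR_ge0//.
exact: (@probability_le1 _ _ _ (normal_prob x s) A mA).
Qed.

(** The bound on [(t - m) ^+ 2] keeps the density above a constant on the interval. The booleans [p]
    and [q] leave each endpoint open or closed, since half-open intervals of both orientations occur
    below. *)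
Lemma normal_prob_itv_ge (R : realType) (m s a b L : R) (p q : bool) :
  s != 0 -> a <= b -> (forall t, a <= t <= b -> (t - m) ^+ 2 <= L) ->
  (((b - a) * (normal_peak s * expR (- L / (s ^+ 2 *+ 2))))%:E
    <= normal_prob m s [set` Interval (BSide p a) (BSide q b)])%E.
Proof.
move=> s0 ab hL.
have s2 : 0 < s ^+ 2 *+ 2 by rewrite pmulrn_lgt0// exprn_even_gt0.
set c := normal_peak s * _.
have c0 : 0 <= c by rewrite mulr_ge0 ?normal_peak_ge0 ?expR_ge0.
have -> : (((b - a) * c)%:E = \int[lebesgue_measure]_(t in
    [set` Interval (BSide p a) (BSide q b)]) (cst c%:E t))%E.
  rewrite integral_cst//= lebesgue_measure_itv/= lte_fin.
  case: ltP => [//|ba]; first by rewrite mulrC EFinM EFinB.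
  have -> : b = a by apply/eqP; rewrite eq_le ab ba.
  by rewrite subrr mul0r mule0.
apply: ge0_le_integral => //=.
- apply/measurable_EFinP/measurable_funTS; exact: measurable_normal_pdf.
- move=> t /= tab.
  have tL : (t - m) ^+ 2 <= L.
    by apply: hL; case/andP: tab; case: p; case: q; rewrite ?bnd_simp => h1 h2;
      apply/andP; split => //; exact: ltW.
  rewrite lee_fin normal_pdfE// ler_wpM2l ?normal_peak_ge0//.
  by rewrite ler_expR ler_pM2r ?invr_gt0// lerN2.
Qed.

Lemma normal_prob_itv_le (R : realType) (m s a b : R) : s != 0 -> a <= b ->
  (normal_prob m s `[a, b] <= ((b - a) * normal_peak s)%:E)%E.
Proof.
move=> s0 ab.
have -> : (((b - a) * normal_peak s)%:E =
    \int[lebesgue_measure]_(t in `[a, b]) (cst (normal_peak s)%:E t))%E.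
  rewrite integral_cst//= lebesgue_measure_itv/= lte_fin.
  case: ltP => [//|ba]; first by rewrite mulrC EFinM EFinB.
  have -> : b = a by apply/eqP; rewrite eq_le ab ba.
  by rewrite subrr mul0r mule0.
apply: ge0_le_integral => //=.
- by move=> t _; rewrite lee_fin normal_pdf_ge0.
- apply/measurable_EFinP/measurable_funTS; exact: measurable_normal_pdf.
- by move=> t _; rewrite lee_fin normal_pdf_ub.
Qed.

(** * Two-sided bounds on the folded normal distribution function *)

Lemma Psi_ge0 (R : realType) (m s x : R) : 0 <= Psi m s x.
Proof. by rewrite /Psi fine_ge0. Qed.

Lemma EFin_Psi (R : realType) (m s x : R) :
  (Psi m s x)%:E = normal_prob m s `[- x, x].
Proof. by rewrite /Psi fineK// fin_num_measure. Qed.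

Lemma Psi_le1 (R : realType) (m s x : R) : Psi m s x <= 1.
Proof. by rewrite -lee_fin EFin_Psi; exact: probability_le1. Qed.

(** The complement of [[-x, x]] consists of two half-lines at distance at least [x - |m|] from [m],
    and the tail bound applies to each. *)
Lemma Psi_ge (R : realType) (m s x : R) : s != 0 -> `|m| <= x ->
  1 - 2 * expR (- (x - `|m|) ^+ 2 / (s ^+ 2 *+ 2)) <= Psi m s x.
Proof.
move=> s0 mx.
have s2 : 0 < s ^+ 2 *+ 2 by rewrite pmulrn_lgt0// exprn_even_gt0.
have /andP[mx1 mx2] : - x <= m <= x by rewrite -ler_norml.
rewrite -lee_fin EFin_Psi.
set e := expR _.
have e1 (y : R) : (x - `|m|) ^+ 2 <= (y - m) ^+ 2 ->
    expR (- (y - m) ^+ 2 / (s ^+ 2 *+ 2)) <= e.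
  by move=> h; rewrite ler_expR ler_pM2r ?invr_gt0// lerN2.
have p1 : (normal_prob m s `]x, +oo[ <= e%:E)%E.
  apply: le_trans; first apply: (@normal_prob_sub_tail _ m s x) => //.
    by move=> t; rewrite /= in_itv/= andbT => xt; apply: mulr_ge0; lra.
  rewrite lee_fin; apply: e1.
  by have := ler_norm m; nra.
have p2 : (normal_prob m s `]-oo, (- x)%R[ <= e%:E)%E.
  apply: le_trans; first apply: (@normal_prob_sub_tail _ m s (- x)) => //.
    by move=> t; rewrite /= in_itv/= => xt; apply: mulr_le0; lra.
  rewrite lee_fin; apply: e1.
  by have := ler_norm (- m); rewrite normrN; nra.
have -> : `[- x, x]%classic = ~` (`]-oo, (- x)%R[ `|` `]x, +oo[).
  apply/seteqP; split => t /=; rewrite !in_itv/= ?andbT.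
    by move=> /andP[h1 h2] [|]; rewrite ltNge ?h1 ?h2.
  by move=> /not_orP[/negP h1 /negP h2]; rewrite !leNgt h1 h2.
rewrite probability_setC; last exact: measurableU.
rewrite EFinB leeB//.
apply: le_trans; first exact: measureU2.
by rewrite mulr_natl mulr2n EFinD leeD.
Qed.


(** An interval of length [h] that starts at distance [u] from [m], on the side of the sign of [m],
    misses [[-x, x]] and stays within [u + h] of [m]. Its mass is lost to [Psi]. The endpoint nearer
    to [m] is left out because [x = |m| + u] is allowed. *)
Lemma Psi_le (R : realType) (m s x u h : R) : s != 0 -> 0 <= u -> 0 <= h ->
  x <= `|m| + u ->
  Psi m s x <= 1 - h * (normal_peak s * expR (- (u + h) ^+ 2 / (s ^+ 2 *+ 2))).
Proof.
move=> s0 u0 h0 xmu.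
suff [I [mI dI IP]] : exists I : set R, [/\ measurable I,
    `[- x, x] `<=` ~` I & ((h * (normal_peak s *
       expR (- (u + h) ^+ 2 / (s ^+ 2 *+ 2))))%:E <= normal_prob m s I)%E].
  rewrite -lee_fin EFin_Psi EFinB.
  apply: (@le_trans _ _ (normal_prob m s (~` I))).
    by apply: le_measure => //; rewrite inE; [exact: measurable_itv|exact: measurableC].
  by rewrite probability_setC// leeB.
have [m0|m0] := leP 0 m.
- rewrite ger0_norm// in xmu.
  exists `](m + u), (m + u + h)]%classic; split => //.
    move=> t /=; rewrite !in_itv/= => /andP[_ tx]; apply/negP.
    by rewrite negb_and -leNgt (le_trans tx xmu).
  rewrite [X in (X * _)%:E](_ : h = m + u + h - (m + u)); last by ring.
  by apply: normal_prob_itv_ge => // [|t /andP[t1 t2]]; [lra|nra].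
- rewrite ltr0_norm// in xmu.
  exists `[(m - u - h), (m - u)[%classic; split => //.
    move=> t /=; rewrite !in_itv/= => /andP[tx _]; apply/negP.
    by rewrite negb_and -!leNgt (le_trans _ tx) ?orbT//; lra.
  rewrite [X in (X * _)%:E](_ : h = m - u - (m - u - h)); last by ring.
  by apply: normal_prob_itv_ge => // [|t /andP[t1 t2]]; [lra|nra].
Qed.

(** * The 0-1 threshold of the powers of [Psi] at scale [sqrt(2 ln n)] *)

Lemma le_normal_peak (R : realType) (s s' : R) : 0 < s <= s' ->
  normal_peak s' <= normal_peak s.
Proof.
move=> /andP[s0 ss']; have s'0 := lt_le_trans s0 ss'.
have p0 := pi_gt0 R.
rewrite /normal_peak lef_pV2 ?posrE ?sqrtr_gt0 ?pmulrn_lgt0 ?mulr_gt0 ?exprn_gt0//.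
rewrite ler_sqrt; last by rewrite pmulrn_lge0// mulr_ge0 ?pi_ge0 ?sqr_ge0.
by rewrite lerMn2r/= ler_pM2r// ler_pXn2r// nnegrE ltW.
Qed.

(** This is what singles out [a = sqrt(2 ln n)]: the Gaussian factor [exp(-a^2/2)] is exactly [1/n],
    the order of missing mass at which an [n]-th power changes regime. *)
Lemma expR_half_sqr_sqrt_ln (R : realType) (n : nat) : (0 < n)%N ->
  expR (Num.sqrt (2 * ln n%:R) ^+ 2 / 2) = n%:R :> R.
Proof.
move=> n0; rewrite sqr_sqrtr; last by rewrite mulr_ge0// ln_ge0// ler1n.
by rewrite mulrC mulKf// lnK// posrE ltr0n.
Qed.

Lemma sqrt_ln_near (R : realType) (A : R) :
  \forall n \near \oo, A <= Num.sqrt (2 * ln n%:R).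
Proof.
near=> n.
have n0 : (0 < n)%N by near: n; exact: nbhs_infty_gt.
have nA : expR (A ^+ 2 / 2) <= n%:R by near: n; exact: nbhs_infty_ger.
rewrite -[leRHS]expR_half_sqr_sqrt_ln// ler_expR in nA.
have a0 : 0 <= Num.sqrt (2 * ln n%:R) :> R := sqrtr_ge0 _.
set a : R := Num.sqrt _ in nA a0 *.
by rewrite leNgt; apply/negP => aA; nra.
Unshelve. all: by end_near. Qed.

(** Applying [Psi_le] with [u = b a - k] and [h = k / 2] shows that [Psi] misses a mass [p] equal to
    a constant times [exp(a w / 2 - w^2 / 8) / n], where [w = k / b]. Hence [n p] grows without
    bound, and [(1 - p)^n <= exp(- n p)]. The lower bound [b0] on [b] bounds [w], which makes the
    rank uniform in [b]. *)
Lemma Psi_exp_near0 (R : realType) (k b0 e : R) : 0 < k -> 0 < b0 -> 0 < e ->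
  \forall n \near \oo, forall b m x : R, b0 <= b <= 1 ->
    x + k <= `|m| + b * Num.sqrt (2 * ln n%:R) -> Psi m b x ^+ n <= e.
Proof.
move=> k0 b00 e0.
have pk : 0 < k / 2 * normal_peak 1 :> R.
  by rewrite mulr_gt0 ?divr_gt0// normal_peak_gt0// oner_eq0.
pose w0 := k / b0.
have w00 : 0 < w0 by rewrite divr_gt0.
(* [B] is the value that [exp(a w / 2 - w^2 / 8)] must reach for [n p >= - ln e]. Below, [a1] makes
   [b a - k] nonnegative, and [a2] brings the exponent itself up to [B]. *)
pose B := (- ln e) / (k / 2 * normal_peak 1).
near=> n => b m x /andP[b0b b1].
have n0 : (0 < n)%N by near: n; exact: nbhs_infty_gt.
have a1 : w0 <= Num.sqrt (2 * ln n%:R) by near: n; exact: sqrt_ln_near.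
have a2 : (B + w0 ^+ 2 / 8) / (k / 2) <= Num.sqrt (2 * ln n%:R).
  by near: n; exact: sqrt_ln_near.
have en := expR_half_sqr_sqrt_ln R n n0.
set a := Num.sqrt _ in a1 a2 en *.
have bp : 0 < b by lra.
have bN0 : b != 0 by rewrite gt_eqF.
pose w := k / b.
have w_ge : k <= w by rewrite /w ler_pdivlMr// ler_piMr// ltW.
have w_le : w <= w0 by rewrite /w /w0 ler_pM2l// lef_pV2// posrE.
move=> hx.
have /(Psi_le R m b x (b * a - k) (k / 2) bN0) : 0 <= b * a - k.
  have -> : k = b * w by rewrite /w; field.
  by rewrite -mulrBr mulr_ge0 ?subr_ge0 ?(le_trans w_le)// ltW.
move=> /(_ ltac:(lra)) /(_ ltac:(lra)).
have -> : - (b * a - k + k / 2) ^+ 2 / (b ^+ 2 *+ 2) =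
    - (a ^+ 2 / 2) + (a * w / 2 - w ^+ 2 / 8).
  by rewrite /w -[b ^+ 2 *+ 2]mulr_natl; field.
rewrite expRD expRN en => hP.
set p := (X in _ <= 1 - X) in hP.
have np : - ln e <= p * n%:R.
  have -> : p * n%:R = k / 2 * normal_peak b * expR (a * w / 2 - w ^+ 2 / 8).
    by rewrite /p; field; rewrite pnatr_eq0 -lt0n.
  have -> : - ln e = k / 2 * normal_peak 1 * B.
    by rewrite /B mulrC divfK// gt_eqF.
  have hB : B <= expR (a * w / 2 - w ^+ 2 / 8).
    apply: le_trans (expR_ge1Dx _).
    rewrite ler_pdivrMr in a2; last by lra.
    have : w ^+ 2 <= w0 ^+ 2 by rewrite ler_pXn2r ?nnegrE//; lra.
    have : a * k <= a * w by rewrite ler_wpM2l// sqrtr_ge0.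
    by lra.
  have hpk : k / 2 * normal_peak 1 <= k / 2 * normal_peak b.
    by rewrite ler_wpM2l ?le_normal_peak ?bp ?b1//; lra.
  apply: (@le_trans _ _ (k / 2 * normal_peak 1 * expR (a * w / 2 - w ^+ 2 / 8))).
    by rewrite ler_wpM2l// ltW.
  by rewrite ler_wpM2r// expR_ge0.
have pe : 1 - p <= expR (- p) by apply: le_trans (expR_ge1Dx _); lra.
apply: (@le_trans _ _ (expR (- p) ^+ n)).
  apply: lerXn2r; rewrite ?nnegrE ?Psi_ge0 ?expR_ge0//.
  exact: le_trans hP pe.
rewrite -expRM_natr -[leRHS]lnK ?posrE// ler_expR; lra.
Unshelve. all: by end_near. Qed.

Lemma bernoulli_ineq (R : realType) (y : R) n : 0 <= y <= 1 ->
  1 - n%:R * y <= (1 - y) ^+ n.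
Proof.
move=> /andP[y0 y1]; elim: n => [|n IH]; first by rewrite expr0; lra.
rewrite exprS -natr1.
have n0 : 0 <= n%:R :> R by exact: ler0n.
have := ler_wpM2l (_ : 0 <= 1 - y) IH => /(_ ltac:(lra)).
by apply: le_trans; nra.
Qed.

(** With margin [b a + k], [Psi_ge] leaves a missing mass of at most [2 q], where
    [q <= exp(- a k) / n] because [b <= 1]. Bernoulli's inequality then bounds the power below by
    [1 - 2 n q]. *)
Lemma Psi_exp_near1 (R : realType) (k e : R) : 0 < k -> 0 < e ->
  \forall n \near \oo, forall b m x : R, 0 < b <= 1 ->
    `|m| + b * Num.sqrt (2 * ln n%:R) + k <= x -> 1 - e <= Psi m b x ^+ n.
Proof.
move=> k0 e0; near=> n => b m x /andP[bp b1].
have n0 : (0 < n)%N by near: n; exact: nbhs_infty_gt.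
(* This gives [2 q <= 1], the range of Bernoulli's inequality. The next bound gives
   [exp(a k) >= 1 + a k >= 2 / e]. *)
have n2 : 2 <= n%:R :> R by near: n; exact: nbhs_infty_ger.
have a2 : 2 / e / k <= Num.sqrt (2 * ln n%:R) by near: n; exact: sqrt_ln_near.
have en := expR_half_sqr_sqrt_ln R n n0.
have a0 : 0 <= Num.sqrt (2 * ln n%:R) :> R := sqrtr_ge0 _.
set a := Num.sqrt _ in a0 a2 en *.
have bN0 : b != 0 by rewrite gt_eqF.
pose w := k / b.
have w_ge : k <= w by rewrite /w ler_pdivlMr// ler_piMr// ltW.
move=> hx.
have ba0 : 0 <= b * a by rewrite mulr_ge0// ltW.
have /Psi_ge : `|m| <= x by lra.
move=> /(_ _ bN0) hP.
set q := expR _ in hP.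
have qle : q <= expR (- (a * k)) / n%:R.
  rewrite -en -expRN -expRD ler_expR mulNr -opprD lerN2.
  have -> : a * k + a ^+ 2 / 2 = (b ^+ 2 *+ 2 * (a * k) + (b * a) ^+ 2) / (b ^+ 2 *+ 2).
    by rewrite -[b ^+ 2 *+ 2]mulr_natl; field.
  rewrite ler_pM2r ?invr_gt0 ?pmulrn_lgt0 ?exprn_gt0//.
  have h1 : (b * a + k) ^+ 2 <= (x - `|m|) ^+ 2.
    by rewrite ler_pXn2r// ?nnegrE; lra.
  have h2 : b * (b * a * k) <= b * a * k.
    by rewrite ler_piMl// mulr_ge0// ltW.
  by apply: le_trans h1; nra.
have q0 : 0 <= q := expR_ge0 _.
have ak : expR (- (a * k)) <= e / 2.
  rewrite expRN -[leRHS]invrK lef_pV2 ?posrE ?expR_gt0 ?invr_gt0 ?divr_gt0//.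
  apply: le_trans (expR_ge1Dx _).
  by rewrite invf_div; move: a2; rewrite ler_pdivrMr//; lra.
have ak1 : expR (- (a * k)) <= 1.
  by rewrite expR_le1 oppr_le0 mulr_ge0// ltW.
have nq : n%:R * (2 * q) <= e.
  have : n%:R * q <= expR (- (a * k)).
    by rewrite mulrC -ler_pdivlMr ?ltr0n.
  by lra.
have q1 : 2 * q <= 1.
  have : q * 2 <= 1.
    apply: le_trans ak1; apply: (@le_trans _ _ (q * n%:R)).
      by rewrite ler_wpM2l.
    by rewrite -ler_pdivlMr ?ltr0n.
  by lra.
apply: (@le_trans _ _ ((1 - 2 * q) ^+ n)).
  by apply: le_trans (bernoulli_ineq _ _ _ _); [lra|rewrite q1 andbT; lra].
by apply: lerXn2r; rewrite ?nnegrE ?Psi_ge0//; lra.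
Unshelve. all: by end_near. Qed.

(** * Measurability of [Psi] and [IPsi] in all their parameters *)

Lemma measurable_fun_invr (R : realType) d (T : measurableType d) (f : T -> R) :
  (forall t, 0 < f t) -> measurable_fun setT f ->
  measurable_fun setT (fun t => (f t)^-1).
Proof.
move=> f0 mf; rewrite (_ : (fun t => (f t)^-1) = (fun t => expR (- ln (f t)))).
  by apply: measurableT_comp => //; apply: measurable_funN; exact: measurableT_comp.
by apply/funext => t; rewrite expRN lnK// posrE.
Qed.

Lemma measurable_fun_sqrtr (R : realType) d (T : measurableType d) (f : T -> R) :
  measurable_fun setT f -> measurable_fun setT (fun t => Num.sqrt (f t)).
Proof.
move=> mf; apply: measurableT_comp => //.
apply: nondecreasing_measurable => // x y; exact: ler_wsqrtr.
Qed.

Lemma measurable_fun_mulrn (R : realType) d (T : measurableType d) (f : T -> R) n :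
  measurable_fun setT f -> measurable_fun setT (fun t => f t *+ n).
Proof. by move=> mf; under eq_fun do rewrite -mulr_natr; exact: measurable_funM. Qed.

(** The condition [- x <= y <= x] moves into the integrand, so that [Psi] becomes a partial integral
    of one nonnegative, jointly measurable function on [T * R], and Tonelli's theorem applies. *)
Lemma measurable_fun_Psi (R : realType) d (T : measurableType d) (m s x : T -> R) :
  (forall t, 0 < s t) ->
  measurable_fun setT m -> measurable_fun setT s -> measurable_fun setT x ->
  measurable_fun setT (fun t => Psi (m t) (s t) (x t)).
Proof.
move=> s0 mm ms mx; apply: measurableT_comp => //.
pose f (ty : T * R) := (if (- x ty.1 <= ty.2) && (ty.2 <= x ty.1) then
  normal_peak (s ty.1) * normal_fun (m ty.1) (s ty.1) ty.2 else 0)%:E.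
rewrite (_ : (fun t => _) = fubini_F (@lebesgue_measure R) f); last first.
  apply/funext => t; rewrite /fubini_F /normal_prob [LHS]integral_mkcond.
  apply: eq_integral => y _; rewrite patchE /f mem_setE in_itv/=.
  by case: ifP => // _; rewrite normal_pdfE ?gt_eqF.
apply: measurable_fun_fubini_tonelli_F; last first.
  move=> ty; rewrite /f lee_fin; case: ifP => // _.
  by rewrite mulr_ge0 ?normal_peak_ge0 ?normal_fun_ge0.
have mc (h : T -> R) : measurable_fun setT h ->
    measurable_fun setT (fun ty : T * R => h ty.1).
  by move=> mh; apply: measurableT_comp.
have ms2 : measurable_fun setT (fun ty : T * R => s ty.1 ^+ 2).
  by apply: measurable_funX; exact: mc.
apply/measurable_EFinP; apply: measurable_fun_ifT => //=.
  apply: measurable_and; apply: measurable_fun_ler => //; last exact: mc.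
  by apply: measurable_funN; exact: mc.
apply: measurable_funM.
  apply: measurable_fun_invr => [ty|].
    by rewrite sqrtr_gt0 pmulrn_lgt0// mulr_gt0 ?pi_gt0// exprn_gt0.
  apply: measurable_fun_sqrtr.
  apply: measurable_fun_mulrn.
  by apply: measurable_funM.
apply: measurableT_comp => //; apply: measurable_funM.
  apply: measurable_funN; apply: measurable_funX; apply: measurable_funB => //.
  exact: mc.
apply: measurable_fun_invr => [ty|]; first by rewrite pmulrn_lgt0// exprn_gt0.
exact: measurable_fun_mulrn.
Qed.

Lemma measurable_phi (R : realType) : measurable_fun setT (@phi R).
Proof. exact: measurable_normal_pdf. Qed.

(** Tonelli's theorem again, now over [z]. The correlation may vary with [t], as it does when it is
    estimated. *)
Lemma measurable_fun_IPsi (R : realType) d (T : measurableType d) (r x : T -> R) n :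
  (forall t, r t < 1) -> measurable_fun setT r -> measurable_fun setT x ->
  measurable_fun setT (fun t => IPsi n (r t) (x t)).
Proof.
move=> r1 mr mx.
pose f (tz : T * R) := (Psi (Num.sqrt (r tz.1) * tz.2) (Num.sqrt (1 - r tz.1))
  (x tz.1) ^+ n * phi tz.2)%:E.
rewrite (_ : (fun t => _) = fine \o fubini_F (@lebesgue_measure R) f)//.
apply: measurableT_comp => //.
apply: measurable_fun_fubini_tonelli_F; last first.
  by move=> tz; rewrite lee_fin mulr_ge0 ?exprn_ge0 ?Psi_ge0 ?normal_pdf_ge0.
have mc (h : T -> R) : measurable_fun setT h ->
    measurable_fun setT (fun ty : T * R => h ty.1).
  by move=> mh; apply: measurableT_comp.
apply/measurable_EFinP; apply: measurable_funM; last first.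
  by apply: measurableT_comp => //; exact: measurable_phi.
apply: measurable_funX; apply: measurable_fun_Psi.
- by move=> tz; rewrite sqrtr_gt0 subr_gt0.
- by apply: measurable_funM => //; apply: measurable_fun_sqrtr; exact: mc.
- by apply: measurable_fun_sqrtr; apply: measurable_funB => //; exact: mc.
- exact: mc.
Qed.

(** * Comparison of Gaussian integrals off an exceptional set *)

Lemma integrable_phi (R : realType) :
  (@lebesgue_measure R).-integrable setT (EFin \o @phi R).
Proof. exact: integrable_normal_pdf. Qed.

(** The difference of the integrands is at most [phi] on [A], both factors lying in [[0, 1]], and at
    most [e * phi] elsewhere. The right-hand side is the integral of the sum of these two bounds. *)
Lemma le_Rintegral_phi (R : realType) (f g : R -> R) (A : set R) (e : R) :
  measurable_fun setT f -> measurable_fun setT g -> measurable A -> 0 <= e ->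
  (forall z, 0 <= f z <= 1) -> (forall z, 0 <= g z <= 1) ->
  (forall z, ~ A z -> `|f z - g z| <= e) ->
  `|Rintegral lebesgue_measure setT (fun z => f z * phi z) -
    Rintegral lebesgue_measure setT (fun z => g z * phi z)| <=
    fine (normal_prob 0 1 A) + e.
Proof.
move=> mf mg mA e0 f01 g01 fgA.
have ip (h : R -> R) : measurable_fun setT h -> (forall z, 0 <= h z <= 1) ->
    lebesgue_measure.-integrable setT (EFin \o (fun z => h z * phi z)).
  move=> mh h01; apply: le_integrable (integrable_phi R) => //.
    by apply/measurable_EFinP/measurable_funM => //; exact: measurable_phi.
  move=> z _; have p0 : 0 <= phi z :> R := normal_pdf_ge0 _ _ _.
  have /andP[h0 h1] := h01 z.
  by rewrite /= lee_fin !ger0_norm ?mulr_ge0// ler_piMl.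
rewrite -RintegralB//; [|exact: ip..].
have iB : lebesgue_measure.-integrable setT
    (EFin \o (fun z => f z * phi z - g z * phi z)).
  exact: (integrableB measurableT (ip f mf f01) (ip g mg g01)).
apply: le_trans; first exact: le_normr_Rintegral.
have iA : lebesgue_measure.-integrable setT (EFin \o (@phi R \_ A)).
  rewrite -restrict_EFin -integrable_mkcond//.
  exact: integrableS (integrable_phi R).
have ie : lebesgue_measure.-integrable setT (EFin \o (fun z => e * @phi R z)).
  exact: integrableZl (integrable_phi R).
have -> : fine (normal_prob 0 1 A) + e =
    Rintegral lebesgue_measure setT (fun z => (@phi R \_ A) z + e * phi z).
  rewrite RintegralD// -Rintegral_mkcond RintegralZl//; last exact: integrable_phi.
  by rewrite [X in _ + e * X](_ : _ = 1) ?mulr1// /Rintegral integral_normal_pdf.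
apply: le_Rintegral => //.
- exact: (integrable_abse iB).
- exact: (integrableD measurableT iA ie).
- move=> z _; have p0 : 0 <= phi z :> R := normal_pdf_ge0 _ _ _.
  rewrite -mulrBl normrM (ger0_norm p0) patchE.
  have /andP[f0 f1] := f01 z; have /andP[g0 g1] := g01 z.
  case: ifPn => [_|/negP zA].
    apply: (@le_trans _ _ (1 * phi z)).
      by rewrite ler_wpM2r// ler_norml; lra.
    by rewrite mul1r lerDl mulr_ge0.
  by rewrite add0r ler_wpM2r// fgA// => Az; apply: zA; rewrite inE.
Qed.

(** The set covers the [z] with [|z| > K] or [l <= |z| <= u]. The union bound combines two Gaussian
    tails with two intervals on which the density is at most its peak. *)
Lemma normal_prob_exceptional (R : realType) (K l u : R) : 0 <= K -> l <= u ->
  fine (normal_prob 0 1 ((`]-oo, (- K)[ `|` `]K, +oo[) `|`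
    (`[l, u] `|` `[- u, - l]))) <=
  2 * expR (- (K ^+ 2 / 2)) + 2 * ((u - l) * normal_peak 1).
Proof.
move=> K0 lu; rewrite -lee_fin fineK; last first.
  by apply: fin_num_measure; repeat apply: measurableU.
have n1 : (1 : R) != 0 by exact: oner_neq0.
have tail (y : R) : y ^+ 2 = K ^+ 2 ->
    expR (- (y - 0) ^+ 2 / (1 ^+ 2 *+ 2)) = expR (- (K ^+ 2 / 2)).
  by move=> yK; rewrite subr0 yK expr1n mulNr.
have t1 : (normal_prob 0 1 `]-oo, (- K)%R[ <= (expR (- (K ^+ 2 / 2)))%:E)%E.
  rewrite -(tail (- K)) ?sqrrN//; apply: normal_prob_sub_tail => // t.
  by rewrite /= in_itv/= => tK; nra.
have t2 : (normal_prob 0 1 `]K, +oo[ <= (expR (- (K ^+ 2 / 2)))%:E)%E.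
  rewrite -(tail K)//; apply: normal_prob_sub_tail => // t.
  by rewrite /= in_itv/= andbT => tK; nra.
have t3 : (normal_prob 0 1 `[l, u] <= ((u - l) * normal_peak 1)%:E)%E.
  exact: normal_prob_itv_le.
have t4 : (normal_prob 0 1 `[(- u)%R, (- l)%R] <= ((u - l) * normal_peak 1)%:E)%E.
  rewrite (_ : u - l = - l - - u); last by ring.
  by apply: normal_prob_itv_le => //; rewrite lerN2.
rewrite !mulr_natl !mulr2n !EFinD.
have mU (A B : set R) : measurable A -> measurable B ->
    (normal_prob 0 1 (A `|` B) <= normal_prob 0 1 A + normal_prob 0 1 B)%E.
  by move=> mA mB; exact: measureU2.
apply: (le_trans (mU _ _ _ _)); [exact: measurableU..|].
apply: leeD; (apply: (le_trans (mU _ _ _ _)) => //); exact: leeD.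
Qed.

(** * Stability of [IPsi] in the correlation, uniformly in its argument *)

(** Passing from [(c, b)] to [(c', b')] moves [c |z|] and [b a] by at most [k / 4] each. A point at
    distance more than [k] from the threshold thus stays on its side with margin at least [k / 2],
    and both powers are within [e] of the same limit, 0 or 1. *)
Lemma Psi_exp_close (R : realType) (n : nat) (a b b' c c' e k x z b0 : R) :
  (forall s m y, b0 <= s <= 1 -> y + k / 2 <= `|m| + s * a -> Psi m s y ^+ n <= e) ->
  (forall s m y, b0 <= s <= 1 -> `|m| + s * a + k / 2 <= y -> 1 - e <= Psi m s y ^+ n) ->
  b0 <= b <= 1 -> b0 <= b' <= 1 -> 0 <= c -> 0 <= c' -> 0 < k ->
  `|(c - c') * `|z| | <= k / 4 -> `|a * (b - b')| <= k / 4 ->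
  k < `|c * `|z| - (x - b * a)| ->
  `|Psi (c * z) b x ^+ n - Psi (c' * z) b' x ^+ n| <= e.
Proof.
move=> hU hL hb hb' c0 c'0 k0.
rewrite !ler_norml => /andP[dz1 dz2] /andP[db1 db2].
have P01 (m s : R) : 0 <= Psi m s x ^+ n <= 1.
  by rewrite exprn_ge0 ?Psi_ge0// exprn_ile1 ?Psi_ge0 ?Psi_le1.
have close0 (p q : R) : 0 <= p <= 1 -> 0 <= q <= 1 -> p <= e -> q <= e -> - e <= p - q <= e.
  by clear; lra.
have close1 (p q : R) : 0 <= p <= 1 -> 0 <= q <= 1 -> 1 - e <= p -> 1 - e <= q ->
    - e <= p - q <= e.
  by clear; lra.
have ncz : `|c * z| = c * `|z| by rewrite normrM ger0_norm.
have nc'z : `|c' * z| = c' * `|z| by rewrite normrM ger0_norm.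
rewrite ltr_normr => /orP[zu|zl].
- by apply: close0 => //; apply: hU => //; rewrite ?ncz ?nc'z; lra.
- by apply: close1 => //; apply: hL => //; rewrite ?ncz ?nc'z; lra.
Qed.

(** Both [p - q] and [(1 - p) - (1 - q)] factor as differences of squares and agree up to sign; the
    sum of the complementary roots is at most 2. This turns control of [sqrt(1 - r)] into control of
    [sqrt r] near a positive [p]. *)
Lemma sqrt_compl_dist (R : realType) (p q : R) : 0 <= p <= 1 -> 0 <= q <= 1 ->
  `|Num.sqrt p - Num.sqrt q| * Num.sqrt p <=
    2 * `|Num.sqrt (1 - p) - Num.sqrt (1 - q)|.
Proof.
move=> /andP[p0 p1] /andP[q0 q1].
have sqrt1 (r : R) : 0 <= r -> Num.sqrt (1 - r) <= 1.
  by move=> ?; rewrite -[leRHS]sqrtr1 ler_wsqrtr//; lra.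
set c := Num.sqrt p; set c' := Num.sqrt q.
set b := Num.sqrt (1 - p); set b' := Num.sqrt (1 - q).
have bE : b ^+ 2 = 1 - p by rewrite sqr_sqrtr ?subr_ge0.
have b'E : b' ^+ 2 = 1 - q by rewrite sqr_sqrtr ?subr_ge0.
have c0 : 0 <= c := sqrtr_ge0 _; have c'0 : 0 <= c' := sqrtr_ge0 _.
have b0 : 0 <= b := sqrtr_ge0 _; have b'0 : 0 <= b' := sqrtr_ge0 _.
apply: (@le_trans _ _ (`|c - c'| * (c + c'))).
  by rewrite ler_wpM2l// lerDl.
rewrite -[X in _ * X](ger0_norm (addr_ge0 c0 c'0)) -normrM -subr_sqr !sqr_sqrtr//.
have -> : p - q = - ((b - b') * (b + b')) by rewrite -subr_sqr bE b'E; ring.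
rewrite normrN normrM mulrC ler_wpM2r// ger0_norm ?addr_ge0//.
by rewrite -[2]/(1 + 1) lerD ?sqrt1.
Qed.

Lemma gauss_tail_small (R : realType) (e : R) : 0 < e ->
  exists2 K : R, 0 < K & 2 * expR (- (K ^+ 2 / 2)) <= e.
Proof.
(* A crude choice suffices: [exp(K^2 / 2) >= 1 + K^2 / 2 >= 2 / e]. *)
move=> e0; exists (4 / e + 1); first by rewrite addr_gt0 ?divr_gt0.
have h : expR (- ((4 / e + 1) ^+ 2 / 2)) <= e / 2.
  rewrite expRN -[leRHS]invrK lef_pV2 ?posrE ?expR_gt0 ?invr_gt0 ?divr_gt0//.
  apply: le_trans (expR_ge1Dx _); rewrite invf_div.
  have : 0 < 4 / e by rewrite divr_gt0.
  by rewrite (_ : 2 / e = 4 / e / 2); [nra|field; rewrite gt_eqF].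
by lra.
Qed.

(** Uniformity in [r] and [x] allows the random estimate and the random maximum to be substituted
    pointwise. The error [eta] is split in thirds: the tails [|z| > K], the two bands of [z] near
    the threshold, and the remaining [z]. *)
Lemma IPsi_stable (R : realType) (rho eta : R) : 0 < rho < 1 -> 0 < eta ->
  exists2 delta : R, 0 < delta & \forall n \near \oo, forall r x : R, 0 <= r < 1 ->
    `|Num.sqrt (2 * ln n%:R) * (Num.sqrt (1 - rho) - Num.sqrt (1 - r))| <= delta ->
    `|IPsi n rho x - IPsi n r x| <= eta.
Proof.
move=> /andP[rho0 rho1] eta0.
set c := Num.sqrt rho; set b := Num.sqrt (1 - rho).
have c0 : 0 < c by rewrite sqrtr_gt0.
have b0 : 0 < b by rewrite sqrtr_gt0 subr_gt0.
have sqrt1 (r : R) : 0 <= r -> Num.sqrt (1 - r) <= 1.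
  by move=> ?; rewrite -[leRHS]sqrtr1 ler_wsqrtr//; lra.
have b1 : b <= 1 by rewrite sqrt1// ltW.
have pk0 : 0 < normal_peak 1 :> R by rewrite normal_peak_gt0// oner_eq0.
set pk := normal_peak (1 : R) in pk0.
have [K K0 KE] := gauss_tail_small R (eta / 3) (divr_gt0 eta0 (ltr0n _ 3)).
(* The two bands have width [2 k / c] each, so this [k] bounds their mass by [eta / 3]. *)
pose k := eta * c / (12 * pk).
have k0 : 0 < k by rewrite divr_gt0 ?mulr_gt0.
(* The three terms serve, in order, to bound the shift of [b a] by [k / 4], to keep [b'] above
   [b / 2], and to bound the shift of [c |z|] by [k / 4] for [|z| <= K]. *)
pose delta := Num.min (k / 4) (Num.min (b / 2) (k * c / (8 * K))).
have d0 : 0 < delta.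
  rewrite !lt_min; apply/and3P; split; [by rewrite divr_gt0|by rewrite divr_gt0|].
  by apply: divr_gt0; exact: mulr_gt0.
have d1 : delta <= k / 4 by rewrite ge_min lexx.
have d2 : delta <= b / 2 by rewrite !ge_min lexx orbT.
have d3 : delta <= k * c / (8 * K) by rewrite !ge_min lexx !orbT.
exists delta => //; near=> n => r x /andP[r0 r1] hd.
(* With [a >= 1], the hypothesis on [a (b - b')] also bounds [b - b'] itself. *)
have a1 : 1 <= Num.sqrt (2 * ln n%:R) :> R by near: n; exact: sqrt_ln_near.
have hU : forall b' m y : R, b / 2 <= b' <= 1 ->
    y + k / 2 <= `|m| + b' * Num.sqrt (2 * ln n%:R) -> Psi m b' y ^+ n <= eta / 3.
  by near: n; apply: Psi_exp_near0; rewrite divr_gt0.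
have hL : forall b' m y : R, b / 2 <= b' <= 1 ->
    `|m| + b' * Num.sqrt (2 * ln n%:R) + k / 2 <= y -> 1 - eta / 3 <= Psi m b' y ^+ n.
  have hL : forall b' m y : R, 0 < b' <= 1 ->
      `|m| + b' * Num.sqrt (2 * ln n%:R) + k / 2 <= y -> 1 - eta / 3 <= Psi m b' y ^+ n.
    by near: n; apply: Psi_exp_near1; rewrite divr_gt0.
  move=> s m y /andP[bs s1]; apply: hL; rewrite s1 andbT.
  by apply: lt_le_trans bs; rewrite divr_gt0.
set a : R := Num.sqrt _ in a1 hU hL hd.
set c' := Num.sqrt r; set b' := Num.sqrt (1 - r) in hd.
have c'0 : 0 <= c' := sqrtr_ge0 _.
have b'0 : 0 < b' by rewrite sqrtr_gt0 subr_gt0.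
have b'1 : b' <= 1 by rewrite sqrt1.
have hbb : `|b - b'| <= delta.
  apply: le_trans hd; rewrite normrM ler_peMl//.
  exact: le_trans a1 (ler_norm _).
have b'b : b / 2 <= b'.
  move: hbb; rewrite ler_norml => /andP[_]; move: d2; clear; lra.
have hcc : `|c - c'| * c <= 2 * delta.
  apply: le_trans (sqrt_compl_dist _ _ _ _ _) _; [by rewrite !ltW|by rewrite r0 ltW|].
  by rewrite ler_pM2l.
have hccK : `|c - c'| * K <= k / 4.
  have h : K * (`|c - c'| * c) <= k * c / 4.
    apply: (@le_trans _ _ (K * (2 * (k * c / (8 * K))))).
      by rewrite ler_pM2l// (le_trans hcc)// ler_pM2l.
    by rewrite le_eqVlt; apply/orP; left; apply/eqP; field; rewrite gt_eqF.
  by rewrite -(ler_pM2r c0); move: h; clear; lra.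
pose y := x - b * a.
(* The band [|c |z| - y| <= k] around the threshold, solved for [|z|]. *)
pose l := (y - k) / c; pose u := (y + k) / c.
have lu : l <= u by rewrite ler_pM2r ?invr_gt0// lerD2l ge0_cp ?ltW.
pose A := ((`]-oo, (- K)[ `|` `]K, +oo[) `|` (`[l, u] `|` `[- u, - l]))%classic : set R.
have mA : measurable A by repeat apply: measurableU.
have pA : fine (normal_prob 0 1 A) <= 2 * (eta / 3).
  apply: le_trans; first by apply: normal_prob_exceptional => //; exact: ltW.
  have -> : u - l = 2 * k / c by rewrite /u /l; field; rewrite gt_eqF.
  have -> : 2 * (2 * k / c * normal_peak 1) = eta / 3.
    by rewrite /k -/pk; field; rewrite !gt_eqF.
  by move: KE; clear; lra.
suff h : `|IPsi n rho x - IPsi n r x| <= fine (normal_prob 0 1 A) + eta / 3.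
  by move: h pA; clear; lra.
have mP (q : R) : q < 1 ->
    measurable_fun setT (fun z => Psi (Num.sqrt q * z) (Num.sqrt (1 - q)) x ^+ n).
  move=> q1; apply: measurable_funX; apply: measurable_fun_Psi => //.
    by move=> z; rewrite sqrtr_gt0 subr_gt0.
have P01 (m s : R) : 0 <= Psi m s x ^+ n <= 1.
  by rewrite exprn_ge0 ?Psi_ge0// exprn_ile1 ?Psi_ge0 ?Psi_le1.
apply: le_Rintegral_phi => //; [exact: mP|exact: mP|by rewrite divr_ge0// ltW|].
move=> z /not_orP[/not_orP[z1 z2] /not_orP[z3 z4]].
rewrite -/c -/c' -/b -/b'.
have zK : `|z| <= K.
  move: z1 z2; rewrite /= !in_itv/= andbT => /negP z1 /negP z2.
  by rewrite ler_norml !leNgt z1 z2.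
have zlu : ~~ (l <= `|z| <= u).
  apply/negP => /andP[zl zu]; have [z0|z0] := leP 0 z.
    by apply: z3; rewrite /= in_itv/= -(ger0_norm z0) zl.
  apply: z4; rewrite /= in_itv/= -lerN2 opprK -[X in _ && X]lerN2 opprK.
  by rewrite -(ltr0_norm z0) zu zl.
have diffz : `|(c - c') * `|z| | <= k / 4.
  rewrite normrM normr_id; apply: le_trans hccK.
  by rewrite ler_wpM2l.
have diffb : `|a * (b - b')| <= k / 4 by apply: le_trans d1.
apply: (Psi_exp_close R n a b b' c c' (eta / 3) k x z (b / 2)) => //.
- by rewrite b1 andbT; have := b0; clear; lra.
- by rewrite b'b.
- exact: ltW.
- rewrite ltr_normr; move: zlu; rewrite negb_and -!ltNge => /orP[zl|zu].
    rewrite /l ltr_pdivlMr// in zl; apply/orP; right.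
    by rewrite opprB ltrBrDr -ltrBrDl mulrC.
  rewrite /u ltr_pdivrMr// in zu; apply/orP; left.
  by rewrite -/y ltrBrDl mulrC.
Unshelve. all: by end_near. Qed.

(** * Transfer to convergence in probability *)

Lemma measurable_Mabs (R : realType) d (T : measurableType d) n (X : 'I_n -> T -> R) :
  (forall i, measurable_fun setT (X i)) -> measurable_fun setT (Mabs X).
Proof.
move=> mX; rewrite /Mabs.
elim: (index_enum _) => [|i s IH].
  by under eq_fun do rewrite big_nil; exact: measurable_cst.
under eq_fun do rewrite big_cons.
by apply: measurable_maxr => //; exact: measurableT_comp.
Qed.

(* [P] is unconstrained on nonmeasurable sets, hence the measurability hypotheses. *)
Lemma cvg_in_prob0_le (R : realType) d (T : measurableType d) (P : probability T R)
    (Y Z : nat -> T -> R) :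
  (forall n, measurable_fun setT (Y n)) -> (forall n, measurable_fun setT (Z n)) ->
  (forall eta, 0 < eta -> exists2 delta, 0 < delta &
    \forall n \near \oo, forall t, `|Y n t| <= delta -> `|Z n t| <= eta) ->
  cvg_in_prob0 P Y -> cvg_in_prob0 P Z.
Proof.
move=> mY mZ YZ cY eta /YZ[delta d0 near_d].
have ms (W : nat -> T -> R) (mW : forall n, measurable_fun setT (W n)) e n :
    measurable [set t | e < `|W n t|].
  rewrite -[X in measurable X]setTI.
  have mlt : measurable_fun setT (fun t => e < `|W n t|).
    by apply: measurable_fun_ltr => //; exact: measurableT_comp.
  exact: (mlt measurableT [set true]).
apply: (@squeeze_cvge _ _ _ _ (cst 0%E) _ (fun n => P [set t | delta < `|Y n t|])).
- near=> n; rewrite measure_ge0/=; apply: le_measure; rewrite ?inE; [exact: ms..|].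
  move=> t /=; rewrite !ltNge; apply: contra.
  by move: t; near: n.
- exact: cvg_cst.
- exact: cY.
Unshelve. all: by end_near. Qed.

Lemma normr_p0B (R : realType) n (p q x : R) :
  `|p0 n p x - p0 n q x| = `|IPsi n p x - IPsi n q x|.
Proof. by rewrite /p0 distrC opprB addrC addrA subrK. Qed.

Theorem theorem2 (R : realType) (d : measure_display) (T : measurableType d)
  (P : probability T R) (rho : R) (hrho0 : 0 < rho) (hrho1 : rho < 1)
  (X : forall n : nat, 'I_n -> {RV P >-> R})
  (HX : forall n : nat, jointly_normal P (fun i => X n i : T -> R)
          (fun=> 0) (equicorr n rho))
  (g : forall n : nat, n.-tuple R -> R)
  (hg : forall n : nat, measurable_fun [set: n.-tuple R] (g n))
  (hrange : forall (n : nat) (t : T),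
      0 <= g n [tuple X n i t | i < n] < 1)
  (hcons : cvg_in_prob0 P (fun n t =>
      Num.sqrt (2 * ln n%:R) *
        (Num.sqrt (1 - rho) - Num.sqrt (1 - g n [tuple X n i t | i < n])))) :
  cvg_in_prob0 P (fun n t =>
      `| IPsi n rho (Mabs (fun i => X n i : T -> R) t)
         - IPsi n (g n [tuple X n i t | i < n]) (Mabs (fun i => X n i : T -> R) t) |)
  /\
  cvg_in_prob0 P (fun n t =>
      p0 n rho (Mabs (fun i => X n i : T -> R) t)
      - p0 n (g n [tuple X n i t | i < n]) (Mabs (fun i => X n i : T -> R) t)).
Proof.
pose r n t := g n [tuple X n i t | i < n].
have mr n : measurable_fun setT (r n).
  apply: (measurableT_comp (hg n)); apply/measurable_fun_tnthP => i.
  rewrite (_ : _ \o _ = X n i); first exact: measurable_funP.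
  by apply/funext => t /=; rewrite tnth_mktuple.
have mM n : measurable_fun setT (Mabs (fun i => X n i : T -> R)).
  by apply: measurable_Mabs => i; exact: measurable_funP.
have mI n : measurable_fun setT (fun t => IPsi n rho (Mabs (fun i => X n i : T -> R) t)).
  exact: measurable_fun_IPsi.
have mIr n : measurable_fun setT
    (fun t => IPsi n (r n t) (Mabs (fun i => X n i : T -> R) t)).
  by apply: measurable_fun_IPsi => // t; case/andP: (hrange n t).
have mY n : measurable_fun setT (fun t => Num.sqrt (2 * ln n%:R) *
    (Num.sqrt (1 - rho) - Num.sqrt (1 - r n t))).
  apply: measurable_funM => //; apply: measurable_funB => //.
  by apply: measurable_fun_sqrtr; exact: measurable_funB.
(* Stability holds at every [t], so smallness of the scaled estimation error forces smallness of
   this signed difference. Both claims concern quantities with the same absolute value. *)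
have main : cvg_in_prob0 P (fun n t =>
    IPsi n rho (Mabs (fun i => X n i : T -> R) t) -
    IPsi n (r n t) (Mabs (fun i => X n i : T -> R) t)).
  apply: cvg_in_prob0_le hcons => // [n|eta eta0]; first exact: measurable_funB.
  have [|delta d0 nd] := IPsi_stable R rho eta _ eta0; first by rewrite hrho0.
  by exists delta => //; apply: filterS nd => n h t; exact: h.
split => e e0.
- by under eq_fun do under eq_set do rewrite normr_id; exact: main.
- by under eq_fun do under eq_set do rewrite normr_p0B; exact: main.
Qed.
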